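(* Let $R$ be a finite set of positive integers and let $\alpha\in[0,|R|)$. Then $\alpha$ is a jump for $R$ if and only if there exists a finite family $\mathcal F$ of $R$-graphs such that (i) $\pi^R(\mathcal F)\le\alpha$ and (ii) $\min_{F\in\mathcal F}\lambda(F)>\alpha$. Moreover, if there exists a finite family $\mathcal F$ of $R$-graphs with $\pi^R(\mathcal F)<\alpha$ and $\min_{F\in\mathcal F}\lambda(F)>\alpha$, then $\alpha$ is a strong jump for $R$.
   Context: A hypergraph is a pair $H=(V,E)$ with $E\subseteq 2^V$; $H$ is an $R$-graph if $|e|\in R$ for every $e\in E$. For an $R$-graph $H$ on $n$ vertices, $h_n(H)=\sum_{e\in E(H)} 1/\binom{n}{|e|}$. For a family $\mathcal F$ of $R$-graphs, $\pi_n(\mathcal F)$ is the maximum of $h_n(G)$ over $\mathcal F$-free $R$-graphs $G$ on $n$ vertices (i.e. $G$ contains no member of $\mathcal F$ as a subgraph), and the Turán density is $\pi^R(\mathcal F)=\lim_{n\to\infty}\pi_n(\mathcal F)$ (this limit exists). For a hypergraph $H$ on vertex set $[n]$, its polynomial form is $\lambda(H,\vec x)=\sum_{e\in E(H)}|e|!\prod_{i\in e}x_i$ and its Lagrangian is $\lambda(H)=\max_{\vec x\in S_n}\lambda(H,\vec x)$, where $S_n=\{\vec x\in[0,1]^n:\sum_i x_i=1\}$. A value $\alpha\in[0,|R|]$ is a jump for $R$ if there exists $c>0$ such that for every $\epsilon>0$ and every integer $t\ge\max R$ there is $n_0$ such that whenever $n\ge n_0$ and $G_n$ is an $R$-graph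 on $n$ vertices with $h_n(G_n)\ge\alpha+\epsilon$, $G_n$ contains a subgraph $H_t$ on $t$ vertices with $h_t(H_t)\ge\alpha+c$. It is a strong jump for $R$ if there exists $c>0$ such that for every integer $t\ge\max R$ there is $n_0$ such that whenever $n\ge n_0$ and $G_n$ is an $R$-graph on $n$ vertices with $h_n(G_n)\ge\alpha-c$, $G_n$ contains a subgraph $H_t$ on $t$ vertices with $h_t(H_t)\ge\alpha+c$. *)

(* Defs.v *)
From HB Require Import structures.
From mathcomp Require Import all_boot all_order all_algebra.
From mathcomp Require Import finmap.
From mathcomp Require Import all_classical all_reals all_analysis.

Set Implicit Arguments.
Unset Strict Implicit.
Unset Printing Implicit Defensive.

Import Order.TTheory GRing.Theory Num.Theory.
Import numFieldNormedType.Exports.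

Local Open Scope classical_set_scope.
Local Open Scope ring_scope.

(* A hypergraph on the vertex set [n], given by its edge set. *)
Definition hypergraph (n : nat) := {set {set 'I_n}}.

Definition Rgraph (R : {fset nat}) (n : nat) (H : hypergraph n) : bool :=
  [forall e in H, #|e| \in R].

Definition density (K : realType) (n : nat) (H : hypergraph n) : K :=
  \sum_(e in H) ('C(n, #|e|)%:R)^-1.

(* G contains a (not necessarily induced) copy of F. *)
Definition contains (n m : nat) (G : hypergraph n) (F : hypergraph m) : bool :=
  [exists f : {ffun 'I_m -> 'I_n},
     injectiveb f && [forall e in F, (f @: (e : {set 'I_m}))%SET \in G]].

Definition hfamily := seq {m : nat & hypergraph m}.

Definition Rfamily (R : {fset nat}) (Fs : hfamily) : bool :=
  all (fun F => Rgraph R (tagged F)) Fs.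

Definition is_free (Fs : hfamily) (n : nat) (G : hypergraph n) : bool :=
  all (fun F => ~~ contains G (tagged F)) Fs.

(* Densities are nonnegative, so the default 0 only matters when no R-graph on
   n vertices is Fs-free (Fs has an edgeless member on at most n vertices). *)
Definition turan (K : realType) (R : {fset nat}) (Fs : hfamily) (n : nat) : K :=
  \big[Num.max/0]_(G : hypergraph n | Rgraph R G && is_free Fs G) density K G.

Definition turan_density (K : realType) (R : {fset nat}) (Fs : hfamily) : K :=
  lim (turan K R Fs n @[n --> \oo]).

Definition simplex (K : realType) (n : nat) : set 'rV[K]_n :=
  [set x | (forall i, 0 <= x ord0 i <= 1) /\ \sum_i x ord0 i = 1].

Definition lagrange_poly (K : realType) (n : nat) (H : hypergraph n)
    (x : 'rV[K]_n) : K :=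
  \sum_(e in H) (#|e| `!)%:R * \prod_(i in e) x ord0 i.

(* For n > 0 this supremum is a maximum, see lagrangian_max;
   for n = 0 it is sup set0 = 0. *)
Definition lagrangian (K : realType) (n : nat) (H : hypergraph n) : K :=
  sup [set lagrange_poly H x | x in @simplex K n].

Lemma lagrangian_max (K : realType) (n : nat) (H : hypergraph n) :
  (0 < n)%N ->
  exists2 x : 'rV[K]_n, simplex x &
    lagrange_poly H x = lagrangian K H /\
    forall y, simplex y -> lagrange_poly H y <= lagrange_poly H x.
Proof.
move=> n_gt0.
have cD : continuous (fun z : K * K => z.1 + z.2) by exact: add_continuous.
have cM : continuous (fun z : K * K => z.1 * z.2) by exact: mul_continuous.
have cx (i : 'I_n) : continuous (fun x : 'rV[K]_n => x ord0 i).
  exact: coord_continuous.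
have cS : compact (@simplex K n).
  have -> : @simplex K n =
      [set x : 'rV[K]_n | forall i, `[0, 1]%classic (x ord0 i)]
      `&` (fun x : 'rV[K]_n => \sum_i x ord0 i) @^-1` [set x | x = 1].
    by apply/seteqP; split=> x /= [h ?]; split=> // i;
      move: (h i); rewrite in_itv.
  apply: compact_closedI.
    by apply: (@rV_compact K n (fun=> `[0, 1]%classic)) => _;
      exact: segment_compact.
  apply: closed_comp; last exact: closed_eq.
  by move=> x _; apply: (continuous_big cD) => i _; exact: cx.
have S0 : @simplex K n !=set0.
  exists (\row_i (i == Ordinal n_gt0)%:R); split=> [i|].
    by rewrite mxE; case: (_ == _); rewrite /= ?lexx ler01.
  rewrite (bigD1 (Ordinal n_gt0)) //= mxE eqxx big1 ?addr0 // => i /negPf ni.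
  by rewrite mxE ni.
have cf : {within @simplex K n, continuous (@lagrange_poly K n H)}.
  apply: continuous_subspaceT; apply: (continuous_big cD) => e _ x.
  apply: (@cvgM K _ (nbhs x) _ (fun=> (#|e| `!)%:R)
    (fun y : 'rV[K]_n => \prod_(i in e) y ord0 i)); first exact: cvg_cst.
  by apply: (continuous_big cM) => i _; exact: cx.
have [x /set_mem Sx xmax] := EVT_max_rV S0 cS cf.
have ub y : simplex y -> lagrange_poly H y <= lagrange_poly H x.
  by move=> Sy; apply: xmax; exact: mem_set.
exists x => //; split=> //; apply/le_anti/andP; split.
  apply: ub_le_sup; last by exists x.
  by exists (lagrange_poly H x) => _ [y Sy <-]; exact: ub.
apply: ge_sup; first by exists (lagrange_poly H x), x.
by move=> _ [y Sy <-]; exact: ub.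
Qed.

(* The default 0 is only used for the empty family, which has no minimum. *)
Definition min_lagrangian (K : realType) (Fs : hfamily) : K :=
  if Fs is F :: Fs' then
    \big[Num.min/lagrangian K (tagged F)]_(G <- Fs') lagrangian K (tagged G)
  else 0.

Definition jump (K : realType) (R : {fset nat}) (alpha : K) : Prop :=
  exists2 c : K, 0 < c &
  forall eps : K, 0 < eps ->
  forall t : nat, (\max_(r <- R) r <= t)%N ->
  exists n0 : nat, forall (n : nat) (G : hypergraph n),
    (n0 <= n)%N -> Rgraph R G -> alpha + eps <= density K G ->
    exists2 H : hypergraph t, contains G H & alpha + c <= density K H.

Definition strong_jump (K : realType) (R : {fset nat}) (alpha : K) : Prop :=
  exists2 c : K, 0 < c &
  forall t : nat, (\max_(r <- R) r <= t)%N ->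
  exists n0 : nat, forall (n : nat) (G : hypergraph n),
    (n0 <= n)%N -> Rgraph R G -> alpha - c <= density K G ->
    exists2 H : hypergraph t, contains G H & alpha + c <= density K H.

(* Main.v *)
(* If [alpha] is a jump with gap [c], take all [R]-graphs on [t] vertices of
   density at least [alpha + c]: uniform weights show that their Lagrangians
   exceed [alpha] once [t] is large.  Conversely, if a large [G] is denser than
   the Turan density of [Fs], supersaturation gives a positive proportion of
   embeddings of some [F] in [Fs], and a dense set of tuples contains a large box
   (Erdos), so [G] contains large blow-ups of [F].  Mapping [t] vertices to those
   of [F] at random according to optimal weights yields blow-ups on [t] vertices
   whose expected density is the Lagrangian of [F]. *)

Require Import Defs.
From mathcomp Require Import all_boot all_order all_algebra.
From mathcomp Require Import finmap.
From mathcomp Require Import all_classical all_reals all_analysis.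
From mathcomp Require Import lra zify.

Set Implicit Arguments.
Unset Strict Implicit.
Unset Printing Implicit Defensive.

Import Order.TTheory GRing.Theory Num.Theory.
Import numFieldNormedType.Exports.

Local Open Scope ring_scope.

(** * Pullbacks and containment *)

(* Since [f] need not be injective, the size condition keeps only the sets on
   which it is; for a non-injective [f] this is a blow-up of [G]. *)
Definition pullback (m n : nat) (f : 'I_m -> 'I_n) (G : hypergraph n) :
    hypergraph m :=
  [set e : {set 'I_m} | (f @: e \in G)%SET && (#|(f @: e)%SET| == #|e|)]%SET.

Lemma Rgraph_card (R : {fset nat}) (n : nat) (G : hypergraph n)
    (e : {set 'I_n}) : Rgraph R G -> e \in G -> #|e| \in R.
Proof. by move=> /forallP /(_ e) /implyP. Qed.

Lemma Rgraph_card_le (R : {fset nat}) (t n : nat) (G : hypergraph n)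
    (e : {set 'I_n}) :
  (\max_(r <- R) r <= t)%N -> Rgraph R G -> e \in G -> (#|e| <= t)%N.
Proof.
move=> Rt RG /(Rgraph_card RG) eR; apply: leq_trans Rt.
exact: (@leq_bigmax_seq _ _ xpredT id).
Qed.

Lemma Rgraph_pullback (R : {fset nat}) (m n : nat) (f : 'I_m -> 'I_n)
    (G : hypergraph n) : Rgraph R G -> Rgraph R (pullback f G).
Proof.
move=> RG; apply/forallP => e; apply/implyP; rewrite inE => /andP[eG /eqP <-].
exact: Rgraph_card eG.
Qed.

Lemma contains_trans (k m n : nat) (G : hypergraph n) (H : hypergraph m)
    (F : hypergraph k) : contains G H -> contains H F -> contains G F.
Proof.
move=> /existsP[f /andP[/injectiveP f_inj /forallP fH]].
move=> /existsP[g /andP[/injectiveP g_inj /forallP gF]].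
apply/existsP; exists [ffun i => f (g i)]; apply/andP; split.
  by apply/injectiveP => i j; rewrite !ffunE => /f_inj /g_inj.
apply/forallP => e; apply/implyP => eF.
have -> : ([ffun i => f (g i)] @: e = f @: (g @: e))%SET.
  by rewrite -imset_comp; apply: eq_imset => i; rewrite /= ffunE.
exact: (implyP (fH _) (implyP (gF _) eF)).
Qed.

Lemma contains_pullback (m n : nat) (f : 'I_m -> 'I_n) (G : hypergraph n) :
  injective f -> contains G (pullback f G).
Proof.
move=> f_inj; apply/existsP; exists (finfun f); apply/andP; split.
  by apply/injectiveP => i j; rewrite !ffunE => /f_inj.
apply/forallP => e; apply/implyP; rewrite inE => /andP[eG _].
by rewrite (eq_imset _ (ffunE f)).
Qed.

Lemma contains_le (m n : nat) (G : hypergraph n) (F : hypergraph m) :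
  contains G F -> (m <= n)%N.
Proof.
move=> /existsP[f /andP[/injectiveP f_inj _]].
by have := leq_card f f_inj; rewrite !card_ord.
Qed.

Lemma is_free_contains (Fs : hfamily) (m n : nat) (G : hypergraph n)
    (H : hypergraph m) : contains G H -> is_free Fs G -> is_free Fs H.
Proof.
move=> GH /allP Gfree; apply/allP => F /Gfree.
by apply: contra; exact: contains_trans.
Qed.

(** * Averaging over vertex deletions, and existence of the Turán density *)

Section Deletion.
Variables (K : realType) (n : nat).
Implicit Types (G : hypergraph n.+1) (v : 'I_n.+1).

Lemma imset_lift_pullback G v :
  ((fun e : {set 'I_n} => lift v @: e) @: pullback (lift v) G =
   [set e in G | v \notin e])%SET.
Proof.
apply/setP => e; rewrite inE; apply/imsetP/idP => [[e' + ->]|/andP[eG ve]].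
  rewrite inE => /andP[-> _] /=; apply/negP => /imsetP[i _ /eqP].
  by rewrite (negPf (neq_lift _ _)).
have eE : e = (lift v @: (lift v @^-1: e))%SET.
  apply/setP => i; apply/idP/imsetP => [ie|[j + ->]]; last by rewrite inE.
  case: (unliftP v i) => [j ij|iv]; last by rewrite -iv ie in ve.
  by exists j => //; rewrite inE -ij.
exists (lift v @^-1: e)%SET => //; rewrite inE -eE eG /=.
by rewrite [X in #|pred_of_set X|]eE card_imset //; exact: lift_inj.
Qed.

Lemma density_pullback_lift G v :
  density K (pullback (lift v) G) =
  \sum_(e in G | v \notin e) ('C(n, #|e|)%:R)^-1.
Proof.
transitivity (\sum_(e in [set e in G | v \notin e]%SET) ('C(n, #|e|)%:R^-1 : K)).
  rewrite -imset_lift_pullback big_imset /=.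
    by apply: eq_bigr => e _; rewrite card_imset //; exact: lift_inj.
  by move=> e1 e2 _ _; apply: imset_inj; exact: lift_inj.
by apply: eq_bigl => e; rewrite inE.
Qed.

(** An edge [e] survives the deletion of the [n.+1 - #|e|] vertices outside it, and [(n.+1 - #|e|) *
    'C(n.+1, #|e|) = n.+1 * 'C(n, #|e|)]. The size condition keeps the binomials nonzero. *)
Lemma sum_density_pullback_lift G : (forall e, e \in G -> (#|e| <= n)%N) ->
  \sum_v density K (pullback (lift v) G) = n.+1%:R * density K G.
Proof.
move=> Gn; under eq_bigr do rewrite density_pullback_lift.
rewrite (exchange_big_dep (mem G)) /=; last by move=> v e _ /andP[].
rewrite mulr_sumr; apply: eq_bigr => e eG.
have -> : \sum_(v | (e \in G) && (v \notin e)) ('C(n, #|e|)%:R^-1 : K) =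
          (n.+1 - #|e|)%:R * 'C(n, #|e|)%:R^-1.
  rewrite sumr_const mulr_natl; congr (_ *+ _).
  rewrite -[X in (X - _)%N]card_ord -(cardC (mem e)) addKn.
  by apply: eq_card => v; rewrite !inE eG.
have C_neq0 m : (#|e| <= m)%N -> ('C(m, #|e|)%:R : K) != 0.
  by move=> em; rewrite pnatr_eq0 -lt0n bin_gt0.
apply: (mulIf (C_neq0 n (Gn e eG))); rewrite mulfVK ?C_neq0 ?Gn //.
apply: (mulIf (C_neq0 n.+1 (leqW (Gn e eG)))).
rewrite mulrAC mulfVK ?C_neq0 ?leqW ?Gn // -!natrM.
by rewrite -(mul_bin_down n.+1).
Qed.

End Deletion.

Lemma density_ge0 (K : realType) (n : nat) (G : hypergraph n) :
  0 <= density K G.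
Proof. by apply: sumr_ge0 => e _; rewrite invr_ge0. Qed.

Lemma average_exists (K : realType) (n : nat) (a : K) (g : 'I_n.+1 -> K) :
  n.+1%:R * a <= \sum_i g i -> exists i, a <= g i.
Proof.
move=> le_ag; apply/not_existsP => /= lt_ga; move: le_ag; apply/negP.
rewrite -ltNge -[n.+1 in ltRHS]card_ord mulr_natl -sumr_const.
apply: ltr_sum => [|i _]; last by rewrite ltNge; apply/negP/lt_ga.
by apply/hasP; exists ord0; rewrite ?mem_index_enum.
Qed.

(** By averaging, some vertex-deleted subgraph of a free graph is at least as dense, and it is still
    free. *)
Lemma turanS_le (K : realType) (R : {fset nat}) (Fs : hfamily) (n : nat) :
  (\max_(r <- R) r <= n)%N -> turan K R Fs n.+1 <= turan K R Fs n.
Proof.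
move=> Rn; apply: bigmax_le => [|G /andP[RG Gfree]].
  exact: bigmax_ge_id.
have [|v] := @average_exists K n (density K G)
  (fun v => density K (pullback (lift v) G)).
  by rewrite sum_density_pullback_lift // => e; exact: Rgraph_card_le Rn RG.
move=> /le_trans; apply; apply: (le_bigmax_cond _ (density K (n:=n))).
rewrite Rgraph_pullback //=; apply: is_free_contains Gfree.
exact/contains_pullback/lift_inj.
Qed.

Lemma turan_cvg (K : realType) (R : {fset nat}) (Fs : hfamily) :
  cvgn (turan K R Fs).
Proof.
pose k := (\max_(r <- R) r)%N.
(* Monotonicity is available only from [k] on, hence the shift. *)
have noninc : {homo (fun n => turan K R Fs (n + k)) :
    i j / (i <= j)%N >-> j <= i}.
  apply/nonincreasing_seqP => i; rewrite addSn; apply: turanS_le.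
  exact: leq_addl.
have lb : has_lbound (range (fun n => turan K R Fs (n + k))).
  by exists 0 => _ [i _ <-]; exact: bigmax_ge_id.
have := nonincreasing_cvgn noninc lb; rewrite (cvg_shiftn k) => h.
by apply/cvg_ex; eexists; exact: h.
Qed.

(** * Counting embeddings, and supersaturation *)

Definition embeddings (m n : nat) (F : hypergraph m) (G : hypergraph n) :
    {set {ffun 'I_m -> 'I_n}} :=
  [set f : {ffun 'I_m -> 'I_n} | injectiveb f &&
     [forall e in F, (f @: (e : {set 'I_m}))%SET \in G]]%SET.

(** Composition with [lift v] sends embeddings into [G] minus [v] injectively to embeddings into [G]
    that avoid [v]. *)
Lemma card_embeddings_pullback_lift (m n : nat) (F : hypergraph m)
    (G : hypergraph n.+1) (v : 'I_n.+1) :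
  (#|embeddings F (pullback (lift v) G)| <=
   #|[set f in embeddings F G | v \notin codom f]%SET|)%N.
Proof.
pose g (f : {ffun 'I_m -> 'I_n}) := [ffun i => lift v (f i)].
have g_inj : injective g.
  move=> f1 f2 /ffunP f12; apply/ffunP => i; apply: (@lift_inj _ v).
  by have := f12 i; rewrite !ffunE.
rewrite -(card_imset _ g_inj); apply/subset_leq_card/fintype.subsetP.
move=> _ /imsetP[f + ->]; rewrite !inE => /andP[/injectiveP f_inj /forallP fF].
rewrite -andbA; apply/and3P; split.
- by apply/injectiveP => i j; rewrite !ffunE => /lift_inj /f_inj.
- apply/forallP => e; apply/implyP => eF.
  have := implyP (fF e) eF; rewrite inE => /andP[+ _]; rewrite -imset_comp.
  suff -> : ([ffun i => lift v (f i)] @: e = (lift v \o f) @: e)%SET by [].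
  by apply: eq_imset => i; rewrite /= ffunE.
- apply/codomP => -[i /eqP]; rewrite ffunE.
  by rewrite (negPf (neq_lift _ _)).
Qed.

(** An embedding of [F] occupies [m] vertices, so it avoids the remaining [n.+1 - m]. *)
Lemma sum_card_embeddings_pullback_lift (m n : nat) (F : hypergraph m)
    (G : hypergraph n.+1) :
  (\sum_v #|embeddings F (pullback (lift v) G)| <=
   (n.+1 - m) * #|embeddings F G|)%N.
Proof.
apply: (@leq_trans (\sum_v #|[set f in embeddings F G | v \notin codom f]%SET|)).
  by apply: leq_sum => v _; exact: card_embeddings_pullback_lift.
rewrite mulnC -sum_nat_const.
under eq_bigr => v _.
  rewrite -sum1_card (eq_bigl (fun f => (f \in embeddings F G) &&
    (v \notin codom f))); last by move=> f; rewrite inE.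
  over.
rewrite (exchange_big_dep (mem (embeddings F G))) /=; last by move=> ? ? _ /andP[].
apply: leq_sum => f Ff; rewrite sum1_card.
have /injectiveP f_inj : injectiveb f by move: Ff; rewrite inE => /andP[].
rewrite -[X in (X - _)%N]card_ord -(cardC (mem (codom f))) card_codom //.
rewrite card_ord addKn; apply: subset_leq_card.
by apply/fintype.subsetP => v; rewrite !inE => /andP[_].
Qed.

(** Bernoulli's inequality [1 - m/(n+1) <= (1 - 1/(n+1))^m] with denominators cleared. *)
Lemma expn_Bernoulli (n m : nat) : ((n.+1 - m) * n.+1 ^ m <= n ^ m * n.+1)%N.
Proof.
elim: m => [|m IH]; first by rewrite subn0 expn0 muln1 mul1n.
rewrite !expnS.
have h : ((n.+1 - m.+1) * n.+1 <= (n.+1 - m) * n)%N by nia.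
apply: leq_trans (_ : (n.+1 - m) * n * n.+1 ^ m <= _)%N.
  by rewrite mulnA leq_mul2r h orbT.
by rewrite mulnAC -[(n * _ * _)%N]mulnA [X in (_ <= X)%N]mulnC leq_mul2r IH orbT.
Qed.

(** Normalised by the number of all maps rather than of injective ones, to fit the density of a set
    of tuples in [dense_contains_box]. The price is that averaging over deletions gives an
    inequality, through [expn_Bernoulli]. *)
Definition embedding_density (K : realType) (m n : nat) (F : hypergraph m)
    (G : hypergraph n) : K := #|embeddings F G|%:R / n%:R ^+ m.

Lemma sum_embedding_density_pullback_lift (K : realType) (m n : nat)
    (F : hypergraph m) (G : hypergraph n.+1) : (0 < n)%N ->
  \sum_v embedding_density K F (pullback (lift v) G) <=
  n.+1%:R * embedding_density K F G.
Proof.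
move=> n_gt0; rewrite /embedding_density -mulr_suml -natr_sum.
have n_gt0' : 0 < n%:R ^+ m :> K by rewrite exprn_gt0 // ltr0n.
rewrite ler_pdivrMr // mulrA mulrAC ler_pdivlMr ?exprn_gt0 ?ltr0n //.
rewrite -!natrX -!natrM ler_nat.
apply: (leq_trans (leq_mul (sum_card_embeddings_pullback_lift F G) (leqnn _))).
rewrite mulnAC [X in (_ <= X)%N]mulnC [X in (_ <= X)%N]mulnA.
by rewrite leq_mul2r expn_Bernoulli orbT.
Qed.

(* Both sides behave monotonically under averaging over the vertex-deleted
   subgraphs, so the case [n = m], where the right-hand side is positive only
   if [G] contains a member of [Fs], implies the general one. *)
Lemma supersaturation (K : realType) (R : {fset nat}) (Fs : hfamily)
    (m : nat) (b : K) :
  (0 < m)%N -> (\max_(r <- R) r <= m)%N -> turan K R Fs m <= b ->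
  exists2 c : K, 0 < c & forall (n : nat) (G : hypergraph n),
    (m <= n)%N -> Rgraph R G ->
    c * (density K G - b) <= \sum_(F <- Fs) embedding_density K (tagged F) G.
Proof.
move=> m_gt0 Rm turan_b.
have emb_ge0 n (G : hypergraph n) (F : {k & hypergraph k}) :
    0 <= embedding_density K (tagged F) G.
  by rewrite mulr_ge0 ?invr_ge0 ?exprn_ge0.
pose M : K := 1 + \sum_(G : hypergraph m) density K G.
have leM (G : hypergraph m) : density K G < M.
  rewrite /M (bigD1 G) //= addrCA ltrDl ltr_pwDl //.
  by apply: sumr_ge0 => *; exact: density_ge0.
have M_gt0 : 0 < M by apply: le_lt_trans (leM finset.set0); exact: density_ge0.
have b_ge0 : 0 <= b by apply: le_trans turan_b; exact: bigmax_ge_id.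
(* If [G] on [m] vertices contains [F], the embedding density of [F] is at least [m^-m]; as
   densities on [m] vertices stay below [M], this [c] brings the left-hand side under [m^-m]. *)
pose c : K := (M * m%:R ^+ m)^-1.
have c_gt0 : 0 < c by rewrite invr_gt0 mulr_gt0 // exprn_gt0 // ltr0n.
exists c => // n + mn; rewrite -(subnK mn).
elim: (n - m)%N => {n mn} [|n IH] G RG.
  have sum_ge0 : 0 <= \sum_(F <- Fs) embedding_density K (tagged F) G.
    exact: sumr_ge0.
  have [Gfree|] := boolP (is_free Fs G).
    apply: le_trans sum_ge0; rewrite pmulr_rle0 // subr_le0.
    apply: le_trans turan_b; apply: (le_bigmax_cond _ (density K (n:=m))).
    by rewrite RG.
  rewrite -has_predC => /hasP[F FFs /=]; rewrite negbK => GF.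
  rewrite (big_rem F) //= -[leLHS]addr0 lerD //; last exact: sumr_ge0.
  have Fm : (tag F <= m)%N := contains_le GF.
  apply: (@le_trans _ _ (m%:R ^+ tag F)^-1).
    apply: (@le_trans _ _ (m%:R ^+ m)^-1); last first.
      by rewrite lef_pV2 ?posrE ?exprn_gt0 ?ltr0n // ler_weXn2l // ler1n.
    rewrite -[leRHS](mulKf (lt0r_neq0 M_gt0)) mulrA mulrAC -invfM.
    rewrite ler_wpM2l ?(ltW c_gt0) //.
    by have := leM G; lra.
  rewrite -[leLHS]mul1r ler_wpM2r ?invr_ge0 ?exprn_ge0 // ler1n card_gt0.
  by move/existsP: GF => [f fF]; apply/set0Pn; exists f; rewrite inE.
have N_gt0 : (0 < n + m)%N by rewrite addn_gt0 m_gt0 orbT.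
rewrite -(ler_pM2l (ltr0Sn K (n + m))).
apply: le_trans (_ : \sum_v \sum_(F <- Fs)
    embedding_density K (tagged F) (pullback (lift v) G) <= _).
  apply: le_trans (ler_sum _ (fun v _ => IH _ (Rgraph_pullback (lift v) RG))).
  rewrite -mulr_sumr sumrB sum_density_pullback_lift.
    by rewrite sumr_const card_ord -[b *+ _]mulr_natl -mulrBr mulrCA.
  by move=> e; apply: Rgraph_card_le RG; exact: leq_trans Rm (leq_addl _ _).
rewrite exchange_big mulr_sumr /=; apply: ler_sum => F _.
exact: sum_embedding_density_pullback_lift.
Qed.

(** * Boxes in dense sets of tuples *)

Lemma exists_subset_card (T : finType) (A : {set T}) (s : nat) :
  (s <= #|A|)%N -> exists2 S : {set T}, S \subset A & #|S| = s.
Proof.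
move=> /card_geqP[l [l_uniq <- lA]]; exists [set x in l]%SET.
  by apply/fintype.subsetP => x; rewrite inE => /lA.
by rewrite cardsE; apply/card_uniqP.
Qed.

(** Counting pairs shows that at least [d/2 * #|X|] points lie in at least [s] of the sets [B y].
    Each such point lies in the common intersection of some [s] of them, and there are at most
    [2 ^ #|Y|] choices of [S]. Having [d/4] in place of [d/2] makes the final contradiction
    strict. *)
Lemma dense_intersection (K : realType) (X I : finType) (B : I -> {set X})
    (Y : {set I}) (s : nat) (d : K) :
  (0 < #|X|)%N -> (0 < #|Y|)%N -> 0 < d -> s%:R <= d / 2 * #|Y|%:R ->
  (forall y, y \in Y -> d * #|X|%:R <= #|B y|%:R) ->
  exists S : {set I}, [/\ S \subset Y, #|S| = s
    & d / 4 / 2 ^+ #|Y| * #|X|%:R <=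
      #|[set x | [forall y in S, x \in B y]]%SET|%:R].
Proof.
move=> X_gt0 Y_gt0 d_gt0 sY dB.
have X_gt0' : 0 < #|X|%:R :> K by rewrite ltr0n.
have two_gt0 : 0 < 2 ^+ #|Y| :> K by rewrite exprn_gt0.
have Y_gt0' : 0 < #|Y|%:R :> K by rewrite ltr0n.
pose D x := [set y in Y | x \in B y]%SET.
pose C (S : {set I}) := [set x | [forall y in S, x \in B y]]%SET.
pose Z := [set x | (s <= #|D x|)%N]%SET.
(* A point outside [Z] lies in fewer than [s] of the sets, a point of [Z] in at most [#|Y|]. *)
have sumB : (\sum_(y in Y) #|B y| <= s * #|X| + #|Y| * #|Z|)%N.
  under eq_bigr => y _ do rewrite -sum1_card.
  rewrite (exchange_big_dep predT) //=.
  apply: (@leq_trans (\sum_x (s + #|Y| * (x \in Z)))%N).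
    apply: leq_sum => x _; rewrite sum1_card.
    rewrite (_ : #|_| = #|D x|); last by apply: eq_card => y; rewrite !inE.
    have DY : (#|D x| <= #|Y|)%N.
      by apply/subset_leq_card/fintype.subsetP => y; rewrite inE => /andP[].
    by rewrite inE; case: leqP => /= h; lia.
  rewrite big_split /= sum_nat_const mulnC -big_distrr /= leq_add2l.
  rewrite leq_mul2l; apply/orP; right.
  by rewrite -sum1_card [leqRHS]big_mkcond; apply: leq_sum => x _; case: (x \in Z).
have Z_ge : d / 2 * #|X|%:R <= #|Z|%:R.
  rewrite -(ler_pM2l Y_gt0').
  have h1 : #|Y|%:R * (d * #|X|%:R) <= (\sum_(y in Y) #|B y|)%:R.
    by rewrite natr_sum mulr_natl -sumr_const; apply: ler_sum => y /dB.
  have h2 : (\sum_(y in Y) #|B y|)%:R <=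
      s%:R * #|X|%:R + #|Y|%:R * #|Z|%:R :> K.
    by rewrite -!natrM -natrD ler_nat.
  have h3 : s%:R * #|X|%:R <= d / 2 * #|Y|%:R * #|X|%:R.
    by rewrite ler_wpM2r // ltW.
  by lra.
have Z_sub : (#|Z| <= \sum_(S in powerset Y | #|S| == s) #|C S|)%N.
  rewrite -sum1_card.
  under [X in (_ <= X)%N]eq_bigr => S _ do rewrite -sum1_card.
  rewrite [X in (_ <= X)%N](exchange_big_dep predT) //= big_mkcond.
  apply: leq_sum => x _; case: ifPn => //; rewrite inE => xZ.
  have [S SD sS] := exists_subset_card xZ.
  rewrite (bigD1 S) //= powersetE sS eqxx andbT.
  have /fintype.subsetP SD' := SD; apply/andP; split.
    by apply/fintype.subsetP => y /SD'; rewrite inE => /andP[].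
  by rewrite inE; apply/forallP => y; apply/implyP => /SD'; rewrite inE => /andP[].
apply/not_existsP => /= noS.
have : (#|Z|%:R : K) <= d / 4 * #|X|%:R.
  apply: (@le_trans _ _ (\sum_(S in powerset Y) d / 4 / 2 ^+ #|Y| * #|X|%:R)).
    apply: (@le_trans _ _ (\sum_(S in powerset Y | #|S| == s) #|C S|%:R)).
      by rewrite -natr_sum ler_nat.
    rewrite big_mkcondr /=; apply: ler_sum => S; rewrite powersetE => SY.
    case: eqP => [Ss|_]; last by rewrite !mulr_ge0 // ?invr_ge0 ltW.
    by rewrite leNgt; apply/negP => /ltW CS; apply: (noS S).
  rewrite sumr_const card_powerset -[_ *+ (2 ^ _)%N]mulr_natl natrX mulrA [_ * (d / 4 / _)]mulrC.
  by rewrite mulfVK // lt0r_neq0.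
have : d / 4 * #|X|%:R < d / 2 * #|X|%:R by rewrite ltr_pM2r //; lra.
by move: Z_ge; lra.
Qed.

Definition ffun_cons (T : finType) (k : nat) (y : T) (f : {ffun 'I_k -> T}) :
    {ffun 'I_k.+1 -> T} :=
  [ffun i => if unlift ord0 i is Some j then f j else y].

Definition ffun_tail (T : finType) (k : nat) (f : {ffun 'I_k.+1 -> T}) :
    {ffun 'I_k -> T} :=
  [ffun i => f (lift ord0 i)].

Lemma ffun_cons_tail (T : finType) (k : nat) (f : {ffun 'I_k.+1 -> T}) :
  ffun_cons (f ord0) (ffun_tail f) = f.
Proof. by apply/ffunP => i; rewrite ffunE; case: unliftP => [j|] ->; rewrite ?ffunE. Qed.

Lemma card_ffun_slices (T : finType) (k : nat)
    (A : {set {ffun 'I_k.+1 -> T}}) :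
  (#|A| <= \sum_y #|[set f | ffun_cons y f \in A]%SET|)%N.
Proof.
rewrite -sum1_card (partition_big (fun f : {ffun _} => f ord0) predT) //=.
apply: leq_sum => y _; rewrite sum1_card.
have tail_inj : {in (fun f : {ffun 'I_k.+1 -> T} => (f \in A) && (f ord0 == y)) &,
    injective (@ffun_tail T k)}.
  move=> f g; rewrite !unfold_in => /andP[_ /eqP fy] /andP[_ /eqP gy] fg.
  by rewrite -(ffun_cons_tail f) -(ffun_cons_tail g) fg fy gy.
rewrite -(card_in_imset tail_inj); apply/subset_leq_card/fintype.subsetP.
move=> _ /imsetP[f /andP[fA /eqP fy] ->].
by rewrite inE -fy ffun_cons_tail.
Qed.

(** Induction on [k]. Many first coordinates have a slice of density at least [d/2]; by
    [dense_intersection], [s] of them have slices with a dense common part. These form the first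
    side of the box, and the induction hypothesis finds the other sides in the common part. *)
Lemma dense_contains_box (K : realType) (s k : nat) (d : K) : 0 < d ->
  exists N : nat, forall T : finType, (N <= #|T|)%N ->
  forall A : {set {ffun 'I_k -> T}}, d * #|T|%:R ^+ k <= #|A|%:R ->
  exists S : 'I_k -> {set T}, (forall i, #|S i| = s) /\
    forall f : {ffun 'I_k -> T}, (forall i, f i \in S i) -> f \in A.
Proof.
elim: k d => [|k IH] d d_gt0.
  exists 0%N => T _ A; rewrite expr0 mulr1 => dA.
  have /card_gt0P[g gA] : (0 < #|A|)%N by rewrite -(ltr0n K); lra.
  exists (fun=> finset.set0); split=> [[]//|f _].
  by rewrite (_ : f = g) //; apply/ffunP => -[].
(* Large enough for [dense_intersection] with density [d / 2]. Only [L] good first coordinates are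
   kept, so that the loss [2 ^+ L] does not depend on [T]. *)
pose L := (Num.bound (4 * s%:R / d)).+1.
have sL : s%:R <= d / 2 / 2 * L%:R.
  have : 4 * s%:R / d < L%:R.
    apply: lt_le_trans (archi_boundP _) _; last by rewrite ler_nat leqnSn.
    by rewrite divr_ge0 ?mulr_ge0 // ltW.
  by rewrite ltr_pdivrMr //; lra.
have d'_gt0 : 0 < d / 2 / 4 / 2 ^+ L by rewrite !divr_gt0 // exprn_gt0.
have [N2 boxN] := IH _ d'_gt0.
(* Ensures that the [d/2 * #|T|] good first coordinates number at least [L]. *)
pose N1 := Num.bound (2 * L%:R / d).
exists (maxn N1 N2).+1 => T; rewrite gtn_max => /andP[N1T N2T] A dA.
have T_gt0 : (0 < #|T|)%N by exact: leq_trans N1T.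
have Tk_gt0 : 0 < #|T|%:R ^+ k :> K by rewrite exprn_gt0 // ltr0n.
pose B y := [set f | ffun_cons y f \in A]%SET.
pose Y0 := [set y | d / 2 * #|T|%:R ^+ k <= #|B y|%:R]%SET.
have cardX : #|{ffun 'I_k -> T}| = (#|T| ^ k)%N by rewrite card_ffun card_ord.
(* A slice outside [Y0] has fewer than [d/2 * #|T|^k] elements, any other at most [#|T|^k]. *)
have Y0_ge : d / 2 * #|T|%:R <= #|Y0|%:R.
  have : (#|A|%:R : K) <= \sum_y (d / 2 * #|T|%:R ^+ k + (y \in Y0)%:R * #|T|%:R ^+ k).
    apply: (@le_trans _ _ (\sum_y #|B y|%:R)).
      by rewrite -natr_sum ler_nat; exact: card_ffun_slices.
    apply: ler_sum => y _; have [_|] := boolP (y \in Y0); last first.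
      by rewrite inE -ltNge mulr0n mul0r addr0 => /ltW.
    rewrite mulr1n mul1r -natrX -cardX ler_wpDl ?ler_nat ?max_card //.
    by rewrite mulr_ge0 // divr_ge0 // ltW.
  under eq_bigr do rewrite -mulrDl.
  rewrite -mulr_suml big_split /= sumr_const -[d / 2 *+ _]mulr_natr.
  have -> : \sum_y ((y \in Y0)%:R : K) = #|Y0|%:R.
    by rewrite -sum1_card natr_sum [RHS]big_mkcond; apply: eq_bigr => y _; case: ifP.
  by move=> /(le_trans dA); rewrite exprS mulrA ler_pM2r //; lra.
have /exists_subset_card[Y /fintype.subsetP YY0 cardY] : (L <= #|Y0|)%N.
  rewrite -(ler_nat K); apply: le_trans Y0_ge.
  have : 2 * L%:R / d < #|T|%:R.
    apply: lt_le_trans (archi_boundP _) _; first by rewrite divr_ge0 ?mulr_ge0 // ltW.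
    by rewrite ler_nat ltnW.
  by rewrite ltr_pdivrMr //; lra.
have [||||y|S [SY cardS dS]] := @dense_intersection K _ _ B Y s (d / 2).
- by rewrite cardX expn_gt0 T_gt0.
- by rewrite cardY.
- by rewrite divr_gt0.
- by rewrite cardY.
- by move=> /YY0; rewrite inE cardX natrX.
have [|S' [cardS' boxS']] := boxN T (ltnW N2T) [set x | [forall y in S, x \in B y]]%SET.
  by move: dS; rewrite cardY cardX natrX.
exists (fun i => if unlift ord0 i is Some j then S' j else S); split=> [i|f fS].
  by case: unliftP.
have /boxS' : forall i, ffun_tail f i \in S' i.
  by move=> i; have := fS (lift ord0 i); rewrite liftK ffunE.
rewrite inE => /forallP /(_ (f ord0)) /implyP.
have := fS ord0; rewrite unlift_none => -> /(_ isT).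
by rewrite inE ffun_cons_tail.
Qed.

(** * Blow-ups inside a box of embeddings *)

(** Vertex [j] is sent to the [j]-th element of the side [S (phi j)]. Distinct sides are disjoint
    because every choice of one vertex per side is injective. *)
Lemma contains_blowup (m n t : nat) (F : hypergraph m) (G : hypergraph n)
    (S : 'I_m -> {set 'I_n}) (phi : 'I_t -> 'I_m) : (0 < t)%N ->
  (forall i, #|S i| = t) ->
  (forall f : {ffun 'I_m -> 'I_n}, (forall i, f i \in S i) ->
     f \in embeddings F G) ->
  contains G (pullback phi F).
Proof.
move=> t_gt0 cardS boxS.
pose iota i (j : 'I_t) : 'I_n := enum_val (cast_ord (esym (cardS i)) j).
have iotaS i j : iota i j \in S i by exact: enum_valP.
have iota_inj i : injective (iota i) by move=> j k /enum_val_inj /cast_ord_inj.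
have boxP (f : {ffun 'I_m -> 'I_n}) : (forall i, f i \in S i) ->
    injective f /\ (forall e, e \in F -> (f @: e)%SET \in G).
  move=> /boxS; rewrite inE => /andP[/injectiveP f_inj /forallP fF].
  by split=> // e; exact/implyP.
pose psi j := iota (phi j) j.
have psi_inj : injective psi.
  move=> j k jk; have [ejk|njk] := eqVneq (phi j) (phi k).
    by move: jk; rewrite /psi ejk => /iota_inj.
  (* A choice that takes the supposed common vertex in both sides, hence is not injective. *)
  pose f := [ffun i => if (i == phi j) || (i == phi k) then psi j else iota i j].
  have [|f_inj _] := boxP f.
    move=> i; rewrite ffunE; have [->|_] := eqVneq i (phi j); first exact: iotaS.
    have [->|_] := eqVneq i (phi k); last exact: iotaS.
    by rewrite jk; exact: iotaS.
  by case/eqP: njk; apply: f_inj; rewrite !ffunE !eqxx orbT.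
apply/existsP; exists (finfun psi); apply/andP; split.
  by apply/injectiveP => j k; rewrite !ffunE => /psi_inj.
apply/forallP => e; apply/implyP; rewrite inE => /andP[eF /imset_injP phi_inj].
(* As [phi] is injective on [e], the values of [psi] on [e] extend to a choice of one vertex per
   side; off [phi @: e] it is arbitrary. *)
pose f := [ffun i => if [pick j in e | phi j == i] is Some j then psi j
                     else iota i (Ordinal t_gt0)].
have [|_ /(_ _ eF)] := boxP f.
  move=> i; rewrite ffunE; case: pickP => [j /andP[_ /eqP <-]|_]; exact: iotaS.
rewrite -imset_comp.
suff -> : (finfun psi @: e = (f \o phi) @: e)%SET by [].
apply: eq_in_imset => j je; rewrite /= !ffunE.
case: pickP => [k /andP[ke /eqP /phi_inj -> //]|/(_ j)].
by rewrite je eqxx.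
Qed.

(** * Random maps and the expected density of a blow-up *)

Section RandomMap.
Variables (K : realType) (I J : finType) (x : I -> K).
Hypothesis sum_x : \sum_i x i = 1.

Lemma sum_prod_weights : \sum_(phi : {ffun J -> I}) \prod_j x (phi j) = 1.
Proof. by rewrite -(bigA_distr_bigA (fun=> x)) big1. Qed.

(** Independence: the condition constrains each coordinate separately, so the sum factors over [J],
    and each coordinate outside [e] contributes [\sum_i x i = 1]. *)
Lemma sum_prod_weights_restrict (e : {set J}) (sigma : {ffun 'I_#|e| -> I}) :
  \sum_(phi : {ffun J -> I} | [ffun k => phi (enum_val k)] == sigma)
    \prod_j x (phi j) = \prod_k x (sigma k).
Proof.
(* The constraint on the value [i] at [j], vacuous when [j] is not in [e]. *)
pose c j i := [forall k : 'I_#|e|, (enum_val k == j) ==> (i == sigma k)].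
have cE (phi : {ffun J -> I}) :
    ([ffun k => phi (enum_val k)] == sigma) = [forall j, c j (phi j)].
  apply/eqP/forallP => [resE j|cphi].
    by apply/forallP => k; apply/implyP => /eqP <-; rewrite -resE ffunE.
  apply/ffunP => k; rewrite ffunE.
  by have /forallP /(_ k) := cphi (enum_val k); rewrite eqxx => /eqP.
transitivity (\sum_(phi : {ffun J -> I})
    \prod_j (if c j (phi j) then x (phi j) else 0)).
  rewrite big_mkcond; apply: eq_bigr => phi _; rewrite cE.
  case: (boolP [forall _, _]) => [/forallP cphi|].
    by apply: eq_bigr => j _; rewrite cphi.
  rewrite negb_forall => /existsP[j /negPf cj].
  by rewrite (bigD1 j) //= cj mul0r.
rewrite -(bigA_distr_bigA (fun j i => if c j i then x i else 0)).
rewrite (bigID (mem e)) /= [X in _ * X]big1 ?mulr1; last first.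
  move=> j je; rewrite -[RHS]sum_x; apply: eq_bigr => i _.
  rewrite (_ : c j i) //; apply/forallP => k; apply/implyP => /eqP kj.
  by move: je; rewrite -kj enum_valP.
rewrite big_enum_val; apply: eq_bigr => k _.
rewrite -big_mkcond /= (big_pred1 (sigma k)) // => i /=.
apply/forallP/eqP => [/(_ k)|-> l]; first by rewrite eqxx => /eqP.
by apply/implyP => /eqP /enum_val_inj ->.
Qed.

Lemma sum_prod_weights_imset (e : {set J}) (g : {set I}) : #|g| = #|e| ->
  \sum_(phi : {ffun J -> I} | (phi @: e)%SET == g) \prod_j x (phi j) =
  (#|g| `!)%:R * \prod_(i in g) x i.
Proof.
move=> ge.
pose Q := [set sigma : {ffun 'I_#|e| -> I} in ffun_on (mem g)
           | injectiveb sigma]%SET.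
pose res (phi : {ffun J -> I}) : {ffun 'I_#|e| -> I} :=
  [ffun k => phi (enum_val k)].
have resQ (phi : {ffun J -> I}) : ((phi @: e)%SET == g) = (res phi \in Q).
  rewrite inE; apply/eqP/andP => [phig|[/ffun_onP on_g /injectiveP res_inj]].
    have /imset_injP phi_inj : #|(phi @: e)%SET| == #|e| by rewrite phig ge.
    split; first by apply/ffun_onP => k; rewrite ffunE -phig imset_f ?enum_valP.
    apply/injectiveP => k l; rewrite !ffunE => /phi_inj kl.
    by apply: enum_val_inj; apply: kl; exact: enum_valP.
  have valE j (je : j \in e) : phi j = res phi (enum_rank_in je j).
    by rewrite ffunE enum_rankK_in.
  apply/eqP; rewrite eqEcard; apply/andP; split.
    by apply/fintype.subsetP => _ /imsetP[j je ->]; rewrite (valE j je) on_g.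
  rewrite ge card_in_imset // => j k je ke; rewrite (valE _ je) (valE _ ke).
  by move=> /res_inj /(congr1 enum_val); rewrite !enum_rankK_in.
rewrite (partition_big res (mem Q)) => [|phi]; last by rewrite resQ.
have -> : (#|g| `!)%:R = #|Q|%:R :> K.
  by rewrite card_inj_ffuns_on card_ord -ge -ffactnn.
rewrite mulr_natl -sumr_const; apply: eq_bigr => sigma.
rewrite -[mem Q sigma]/(sigma \in Q) => sQ.
rewrite (eq_bigl (fun phi => res phi == sigma)); last first.
  by move=> phi; rewrite resQ; case: eqP => [->|]; rewrite ?andbF // sQ.
rewrite sum_prod_weights_restrict.
move: sQ; rewrite inE => /andP[/ffun_onP on_g /injectiveP s_inj].
have <- : (sigma @: [set: 'I_#|e|] = g)%SET.
  apply/eqP; rewrite eqEcard card_imset // cardsT card_ord ge leqnn andbT.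
  by apply/fintype.subsetP => _ /imsetP[k _ ->]; exact: on_g.
rewrite big_imset /=; last by move=> ? ? _ _; exact: s_inj.
by apply: eq_bigl => k; rewrite inE.
Qed.

End RandomMap.

(** The index sets no longer depend on [phi], so that the expectation can be taken term by term. *)
Lemma density_pullback (K : realType) (t m : nat) (phi : 'I_t -> 'I_m)
    (F : hypergraph m) :
  density K (pullback phi F) =
  \sum_(g in F) \sum_(e : {set 'I_t} | #|e| == #|g|)
    ((phi @: e)%SET == g)%:R * ('C(t, #|g|)%:R)^-1.
Proof.
rewrite (exchange_big_dep predT) //= /density big_mkcond; apply: eq_bigr => e _.
rewrite inE; case: ifPn => [/andP[phiF /eqP phie]|phiN].
  rewrite (bigD1 (phi @: e)%SET) /=; last by rewrite phiF phie eqxx.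
  rewrite eqxx mul1r phie big1 ?addr0 // => g /andP[_ /negPf ng].
  by rewrite eq_sym ng mul0r.
rewrite big1 // => g /andP[gF /eqP eg]; case: eqP => [phig|_]; rewrite ?mul0r //.
by move: phiN; rewrite phig gF eg eqxx.
Qed.

(* Choosing the images of the vertices independently with distribution [x]
   gives a random blow-up whose expected density is exactly the polynomial form. *)
Lemma expected_density_pullback (K : realType) (t m : nat) (F : hypergraph m)
    (x : 'rV[K]_m) :
  \sum_i x ord0 i = 1 -> (forall e, e \in F -> (#|e| <= t)%N) ->
  \sum_(phi : {ffun 'I_t -> 'I_m})
    (\prod_j x ord0 (phi j)) * density K (pullback phi F) = lagrange_poly F x.
Proof.
move=> sum_x Ft.
transitivity (\sum_(phi : {ffun 'I_t -> 'I_m}) \sum_(g in F)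
    \sum_(e : {set 'I_t} | #|e| == #|g|)
      (\prod_j x ord0 (phi j)) *
      (((phi @: e)%SET == g)%:R * ('C(t, #|g|)%:R)^-1)).
  apply: eq_bigr => phi _; rewrite density_pullback mulr_sumr.
  by apply: eq_bigr => g _; rewrite mulr_sumr.
rewrite exchange_big /=; apply: eq_bigr => g gF; rewrite exchange_big /=.
transitivity (\sum_(e : {set 'I_t} | #|e| == #|g|)
    ('C(t, #|g|)%:R^-1 * (#|g| `!%:R * \prod_(i in g) x ord0 i))).
  apply: eq_bigr => e /eqP eg.
  rewrite -(sum_prod_weights_imset sum_x (esym eg)) mulr_sumr [RHS]big_mkcond.
  apply: eq_bigr => phi _; case: eqP => _; last by rewrite mul0r mulr0.
  by rewrite mul1r mulrC.
(* The ['C(t, #|g|)] sets [e] contribute equally and cancel the weight. *)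
rewrite (eq_bigl (fun e : {set 'I_t} => e \in [set A : {set 'I_t} | #|A| == #|g|]%SET)).
  rewrite sumr_const card_draws card_ord -[_ *+ 'C(_, _)]mulr_natl mulVKf //.
  by rewrite pnatr_eq0 -lt0n bin_gt0 Ft.
by move=> e; rewrite inE.
Qed.

(** Some outcome reaches the expectation, which under optimal weights is the Lagrangian. *)
Lemma exists_dense_pullback (K : realType) (t m : nat) (F : hypergraph m) :
  (0 < m)%N -> (forall e, e \in F -> (#|e| <= t)%N) ->
  exists phi : 'I_t -> 'I_m, lagrangian K F <= density K (pullback phi F).
Proof.
move=> m_gt0 Ft; have [x [x01 sum_x] [<- _]] := lagrangian_max K F m_gt0.
rewrite -(expected_density_pullback sum_x Ft).
set l := \sum_phi _; pose w (phi : {ffun 'I_t -> 'I_m}) := \prod_j x ord0 (phi j).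
have w_ge0 phi : 0 <= w phi by apply: prodr_ge0 => j _; case/andP: (x01 (phi j)).
apply/not_existsP => /= lt_l.
have lt_l' (phi : {ffun 'I_t -> 'I_m}) : density K (pullback phi F) < l.
  by rewrite ltNge; exact/negP/lt_l.
(* If all densities were below [l], these nonnegative terms with sum zero would vanish, forcing
   every weight to be zero although the weights add up to 1. *)
have sum0 : \sum_phi w phi * (l - density K (pullback phi F)) = 0.
  under eq_bigr do rewrite mulrBr.
  by rewrite sumrB -mulr_suml (sum_prod_weights _ sum_x) mul1r subrr.
have w0 phi : w phi = 0.
  have /psumr_eq0P -/(_ sum0 phi isT)/eqP : forall phi, true ->
      0 <= w phi * (l - density K (pullback phi F)).
    by move=> f _; rewrite mulr_ge0 // subr_ge0 ltW.
  by rewrite mulf_eq0 subr_eq0 (gt_eqF (lt_l' phi)) orbF => /eqP.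
have := sum_prod_weights 'I_t sum_x; rewrite big1 => [/esym/eqP|phi _].
  by rewrite oner_eq0.
exact: w0.
Qed.

(** * From a family to dense subgraphs *)

Lemma min_lagrangian_le (K : realType) (Fs : hfamily)
    (F : {m : nat & hypergraph m}) :
  F \in Fs -> min_lagrangian K Fs <= lagrangian K (tagged F).
Proof.
case: Fs => // F0 Fs; rewrite inE => /predU1P[->|FFs]; first exact: bigmin_le_id.
exact: bigmin_inf_seq FFs isT (lexx _).
Qed.

Lemma lt_min_lagrangian (K : realType) (Fs : hfamily) (a : K) :
  Fs != [::] -> (forall F, F \in Fs -> a < lagrangian K (tagged F)) ->
  a < min_lagrangian K Fs.
Proof.
case: Fs => // F0 Fs _ aF; rewrite /min_lagrangian big_seq.
apply: lt_bigmin => [|F FFs]; first by apply: aF; rewrite mem_head.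
by apply: aF; rewrite inE FFs orbT.
Qed.

(** The simplex is empty here. This excludes members without vertices from a family whose
    Lagrangians are positive. *)
Lemma lagrangian0 (K : realType) (H : hypergraph 0) : lagrangian K H = 0.
Proof.
rewrite /lagrangian (_ : image _ _ = classical_sets.set0) ?sup0 //.
apply/seteqP; split=> // y [x [_ /eqP]].
by rewrite big_ord0 eq_sym oner_eq0.
Qed.

(** Serves both jumps and strong jumps: [b] is taken just above [alpha] for the former and just
    below it for the latter. *)
Lemma dense_contains_dense (K : realType) (R : {fset nat}) (Fs : hfamily)
    (b : K) (t : nat) :
  (0 < t)%N -> (\max_(r <- R) r <= t)%N -> Rfamily R Fs ->
  0 < min_lagrangian K Fs -> turan_density K R Fs < b ->
  exists n0 : nat, forall (n : nat) (G : hypergraph n),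
    (n0 <= n)%N -> Rgraph R G -> b <= density K G ->
    exists2 H : hypergraph t, contains G H &
      min_lagrangian K Fs <= density K H.
Proof.
move=> t_gt0 Rt /allP RFs l_gt0 pi_b.
(* The midpoint: some finite [m] already has Turán value at most [b'], and a positive excess
   [b - b'] remains for supersaturation. *)
pose b' := (turan_density K R Fs + b) / 2.
have pi_b' : turan_density K R Fs < b' by rewrite /b'; lra.
have b'_b : b' < b by rewrite /b'; lra.
have [m [m_gt0 Rm turan_b']] : exists m : nat,
    [/\ (0 < m)%N, (\max_(r <- R) r <= m)%N & turan K R Fs m <= b'].
  have [N _ hN] := cvgr_lt _ (@turan_cvg K R Fs) _ pi_b'.
  pose m := (maxn N (\max_(r <- R) r)).+1.
  exists m; split=> //; first by rewrite leqW // leq_maxr.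
  by apply/ltW/hN; rewrite /= leqW // leq_maxl.
have [c c_gt0 super] := supersaturation m_gt0 Rm turan_b'.
(* The average share of one member of [Fs]; some member reaches it. *)
pose d := c * (b - b') / (size Fs)%:R.
(* The empty family has [min_lagrangian] equal to the default 0. *)
have Fs_gt0 : (0 < size Fs)%N.
  by case: (Fs) l_gt0 => //; rewrite ltxx.
have d_gt0 : 0 < d by rewrite divr_gt0 ?mulr_gt0 ?subr_gt0 ?ltr0n.
have /choice[N boxN] := fun k => dense_contains_box t k d_gt0.
exists (maxn m (\max_(F <- Fs) N (tag F)))%N => n G.
rewrite geq_max => /andP[mn Nn] RG bG.
have n_gt0 : (0 < n)%N by exact: leq_trans mn.
have [F FFs dF] : exists2 F, F \in Fs & d <= embedding_density K (tagged F) G.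
  apply: contrapT => noF.
  have : \sum_(F <- Fs) embedding_density K (tagged F) G < c * (b - b').
    rewrite (_ : c * (b - b') = \sum_(F <- Fs) d).
      rewrite !big_seq; apply: ltr_sum => [|F FFs].
        by case: (Fs) Fs_gt0 => // F Fs' _; rewrite /= mem_head.
      by rewrite ltNge; apply/negP => dF; apply: noF; exists F.
    rewrite big_const_seq count_predT iter_addr_0 -[RHS]mulr_natr.
    by rewrite mulfVK // pnatr_eq0 -lt0n.
  apply/negP; rewrite -leNgt; apply: le_trans (super n G mn RG).
  by rewrite ler_pM2l // lerD2r.
have NF : (N (tag F) <= #|'I_n|)%N.
  rewrite card_ord; apply: leq_trans Nn.
  exact: (leq_bigmax_seq (F := fun F => N (tag F))).
have [|S [cardS boxS]] := boxN (tag F) 'I_n NF (embeddings (tagged F) G).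
  by move: dF; rewrite /embedding_density card_ord ler_pdivlMr ?exprn_gt0 ?ltr0n.
have lF := min_lagrangian_le K FFs.
have F_gt0 : (0 < tag F)%N.
  case: F {FFs dF NF S cardS boxS} lF => -[|k] //= F.
  by rewrite lagrangian0 leNgt l_gt0.
have [|phi phiP] := @exists_dense_pullback K t _ (tagged F) F_gt0.
  by move=> e; apply: Rgraph_card_le Rt _; exact: RFs.
exists (pullback phi (tagged F)); last exact: le_trans phiP.
exact: contains_blowup cardS boxS.
Qed.

(** * From a jump to a family *)

(** The estimate [t ^_ r >= (1 - r^2/t) * t^r] multiplied by [t]. *)
Lemma ffact_lower (t r : nat) : (t ^ r * t <= t ^_ r * t + r ^ 2 * t ^ r)%N.
Proof.
elim: r => [|r IH]; first by rewrite expn0 ffactn0 leq_addr.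
have le_p : (t ^_ r <= t ^ r)%N.
  by elim: r {IH} => // r IH; rewrite ffactnSr expnSr leq_mul // leq_subr.
rewrite ffactnSr expnSr.
have := leq_subr r t; move: (t ^_ r)%N (t ^ r)%N IH le_p => a p IH le_p tr.
have h : (a * t <= a * (t - r) + a * r)%N by nia.
nia.
Qed.

(** Under uniform weights an edge of size [r] contributes [r!/t^r], which is [t ^_ r / t^r] times
    its weight [1/'C(t, r)] in the density; [ffact_lower] bounds this ratio. *)
Lemma density_le_lagrangian (K : realType) (k t : nat) (H : hypergraph t) :
  (0 < t)%N -> (forall e, e \in H -> (#|e| <= k)%N) ->
  (1 - k%:R ^+ 2 / t%:R) * density K H <= lagrangian K H.
Proof.
move=> t_gt0 Hk.
have t_gt0' : 0 < t%:R :> K by rewrite ltr0n.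
have [x _ [<- xmax]] := lagrangian_max K H t_gt0.
apply: le_trans (xmax (\row__ t%:R^-1) _); last first.
  split=> [i|]; first by rewrite mxE invr_ge0 ler0n invf_le1 ?ler1n.
  under eq_bigr do rewrite mxE.
  by rewrite sumr_const card_ord -[_ *+ t]mulr_natr mulVf ?lt0r_neq0.
rewrite mulr_sumr; apply: ler_sum => e eH; set r := #|e|.
under eq_bigr do rewrite mxE.
rewrite prodr_const -/r exprVn.
have rt : (r <= t)%N by rewrite -[t]card_ord max_card.
have C_gt0 : 0 < 'C(t, r)%:R :> K by rewrite ltr0n bin_gt0.
have tr_gt0 : 0 < t%:R ^+ r :> K by rewrite exprn_gt0.
rewrite ler_pdivrMr // [leRHS]mulrAC ler_pdivlMr // -natrM mulnC bin_ffact.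
rewrite -(ler_pM2r t_gt0') mulrAC mulrBl mulfVK ?lt0r_neq0 // mul1r mulrBl.
rewrite lerBlDr -natrX -!natrM.
apply: (@le_trans _ _ (t ^_ r * t + r ^ 2 * t ^ r)%:R).
  by rewrite ler_nat mulnC ffact_lower.
by rewrite natrD lerD2l -natrX -natrM ler_nat leq_mul2r leq_sqr Hk ?orbT.
Qed.

Lemma Rgraph_contains (R : {fset nat}) (m n : nat) (G : hypergraph n)
    (H : hypergraph m) : contains G H -> Rgraph R G -> Rgraph R H.
Proof.
move=> /existsP[f /andP[/injectiveP f_inj /forallP fH]] RG.
apply/forallP => e; apply/implyP => /(implyP (fH e)) /(Rgraph_card RG).
by rewrite card_imset.
Qed.

Lemma density_complete (K : realType) (R : {fset nat}) (n : nat) :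
  (\max_(r <- R) r <= n)%N ->
  density K [set e : {set 'I_n} | #|e| \in R]%SET = #|` R|%:R.
Proof.
move=> Rn; rewrite /density.
transitivity (\sum_(r <- R) \sum_(e : {set 'I_n} | #|e| == r) ('C(n, r)%:R^-1 : K)).
  rewrite (exchange_big_dep predT) //= big_mkcond; apply: eq_bigr => e _.
  rewrite inE; case: ifPn => eR.
    under eq_bigl do rewrite eq_sym.
    by rewrite (fbig_pred1_inj (k := id)).
  by rewrite big1_seq // => r /andP[/eqP <-]; rewrite (negPf eR).
rewrite (eq_big_seq (fun=> 1)) => [|r rR].
  by rewrite big_const_seq count_predT iter_addr_0.
rewrite (eq_bigl (fun e => e \in [set A : {set 'I_n} | #|A| == r]%SET)).
  rewrite sumr_const card_draws card_ord -[_ *+ _]mulr_natr mulVf //.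
  rewrite pnatr_eq0 -lt0n bin_gt0; apply: leq_trans Rn.
  exact: (@leq_bigmax_seq _ _ xpredT id).
by move=> e; rewrite inE.
Qed.

Lemma jump_family (K : realType) (R : {fset nat}) (alpha : K) :
  0 <= alpha -> alpha < #|` R|%:R -> jump R alpha ->
  exists Fs : hfamily,
    [/\ Rfamily R Fs, turan_density K R Fs <= alpha
      & alpha < min_lagrangian K Fs].
Proof.
move=> alpha_ge0 alpha_lt [c c_gt0 jmp].
pose k := (\max_(r <- R) r)%N.
(* Chosen so that [k^2 * (alpha + c) / t < c], that is, [(1 - k^2/t) * (alpha + c) > alpha]. *)
pose t := (maxn k (Num.bound (k%:R ^+ 2 * (alpha + c) / c))).+1.
have kt : (k <= t)%N by rewrite leqW // leq_maxl.
have t_gt0 : 0 < t%:R :> K by rewrite ltr0n.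
have lt_t : k%:R ^+ 2 * (alpha + c) / c < t%:R.
  apply: lt_le_trans (archi_boundP _) _.
    by rewrite divr_ge0 ?mulr_ge0 ?exprn_ge0 ?addr_ge0 // ltW.
  by rewrite ler_nat leqW // leq_maxr.
pose P := [pred H : hypergraph t | Rgraph R H && (alpha + c <= density K H)].
pose Fs : hfamily := [seq existT _ t H | H <- enum P].
have FsP F : F \in Fs -> exists2 H : hypergraph t, F = existT _ t H & P H.
  by move=> /mapP[H]; rewrite mem_enum => PH ->; exists H.
have PFs (H : hypergraph t) : P H -> existT _ t H \in Fs.
  by move=> PH; apply: map_f; rewrite mem_enum.
have contFs eps : 0 < eps -> exists n0, forall n (G : hypergraph n),
    (n0 <= n)%N -> Rgraph R G -> alpha + eps <= density K G ->
    exists2 H : hypergraph t, contains G H & P H.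
  move=> /jmp/(_ t kt)[n0 Hn0]; exists n0 => n G n0n RG hG.
  have [H GH hH] := Hn0 n G n0n RG hG; exists H => //=.
  by rewrite hH andbT; exact: Rgraph_contains RG.
exists Fs; split.
- by apply/allP => F /FsP[H -> /andP[]].
- apply/ler_addgt0Pr => eps eps_gt0; apply: limr_le; first exact: turan_cvg.
  have [n0 Hn0] := contFs _ eps_gt0.
  exists n0 => // n /= n0n; apply: bigmax_le => [|G /andP[RG /allP Gfree]].
    by rewrite addr_ge0 // ltW.
  rewrite leNgt; apply/negP => /ltW /(Hn0 n G n0n RG)[H GH /PFs /Gfree].
  by rewrite /= GH.
- apply: lt_min_lagrangian => [|F /FsP[H -> /andP[RH hH]] /=].
    have [|n0 Hn0] := contFs (#|` R|%:R - alpha); first by rewrite subr_gt0.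
    pose n := maxn n0 k.
    have [||H _ /PFs] := Hn0 n [set e : {set 'I_n} | #|e| \in R]%SET (leq_maxl _ _).
    + by apply/forallP => e; apply/implyP; rewrite inE.
    + by rewrite density_complete ?leq_maxr // addrC subrK.
    by case: (Fs).
  have := @density_le_lagrangian K k t H isT _.
  move=> /(_ (fun e => Rgraph_card_le (leqnn _) RH)); apply: lt_le_trans.
  have k_lt1 : k%:R ^+ 2 * (alpha + c) / t%:R < c.
    by rewrite ltr_pdivrMr // [ltRHS]mulrC -ltr_pdivrMr.
  have a1 : 0 <= 1 - k%:R ^+ 2 / t%:R :> K.
    rewrite subr_ge0 -(@ler_pM2r _ (alpha + c)) ?mul1r; last by lra.
    by rewrite mulrAC; lra.
  apply: lt_le_trans (ler_wpM2l a1 hH).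
  by rewrite mulrBl mul1r mulrAC; lra.
Qed.

(** * The characterisation of jumps and the criterion for strong jumps *)

Theorem theorem4 (K : realType) (R : {fset nat}) (alpha : K)
    (R_pos : forall r : nat, r \in R -> (0 < r)%N)
    (alpha_ge0 : 0 <= alpha) (alpha_lt : alpha < #|` R|%:R) :
  (jump R alpha <->
   exists Fs : hfamily,
     [/\ Rfamily R Fs, turan_density K R Fs <= alpha
       & alpha < min_lagrangian K Fs]) /\
  ((exists Fs : hfamily,
      [/\ Rfamily R Fs, turan_density K R Fs < alpha
        & alpha < min_lagrangian K Fs]) ->
   strong_jump R alpha).
Proof.
have t_gt0 t : (\max_(r <- R) r <= t)%N -> (0 < t)%N.
  have /fset0Pn[r rR] : R != fset0.
    by rewrite -cardfs_gt0 -(ltr0n K); exact: le_lt_trans alpha_lt.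
  move=> /(leq_trans _); apply; apply: (leq_trans (R_pos r rR)).
  exact: (@leq_bigmax_seq _ _ xpredT id).
split; [split|].
- exact: jump_family.
- move=> [Fs [RFs pi_le lt_l]].
  (* The gap depends on neither [eps] nor [t]. *)
  exists (min_lagrangian K Fs - alpha); first by rewrite subr_gt0.
  move=> eps eps_gt0 t Rt.
  have [||n0 Hn0] := dense_contains_dense (b := alpha + eps) (t_gt0 t Rt) Rt RFs.
  + exact: le_lt_trans lt_l.
  + by rewrite (le_lt_trans pi_le) // ltrDl.
  exists n0 => n G n0n RG hG; have [H GH hH] := Hn0 n G n0n RG hG.
  by exists H => //; rewrite addrC subrK.
- move=> [Fs [RFs pi_lt lt_l]].
  (* The first term gives [alpha + c <= min_lagrangian K Fs]; the second, being half the distance,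
     keeps [alpha - c] strictly above the Turán density. *)
  pose c := Num.min (min_lagrangian K Fs - alpha)
    ((alpha - turan_density K R Fs) / 2).
  have c_le1 : c <= min_lagrangian K Fs - alpha by rewrite ge_min lexx.
  have c_le2 : c <= (alpha - turan_density K R Fs) / 2.
    by rewrite ge_min lexx orbT.
  exists c; first by rewrite lt_min subr_gt0 lt_l divr_gt0 ?subr_gt0.
  move=> t Rt.
  have [||n0 Hn0] := dense_contains_dense (b := alpha - c) (t_gt0 t Rt) Rt RFs.
  + exact: le_lt_trans lt_l.
  + by lra.
  exists n0 => n G n0n RG hG; have [H GH hH] := Hn0 n G n0n RG hG.
  by exists H => //; apply: le_trans hH; lra.
Qed.
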